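(* Let $(W,S)$ be a right-angled Coxeter system, let $q=(q_s)_{s\in S}\in\mathbb{R}_{>0}^S$, and let $\mathcal{H}=\mathbb{C}(W,S,q)$ be the Iwahori-Hecke algebra of type $(W,S)$ with parameter $q$ and standard basis $(T_w)_{w\in W}$. (1) For every conjugacy class $\mathcal{O}\subseteq W$ there is a unique trace $\varphi_{\mathcal{O}}$ on $\mathcal{H}$ satisfying $\varphi_{\mathcal{O}}(T_w)=\mathbb{1}_{\mathcal{O}}(w)$ for every $w\in W$ that is of minimal length in its conjugacy class. (2) The assignment $(c_{\mathcal{O}})_{\mathcal{O}}\mapsto\sum_{\mathcal{O}}c_{\mathcal{O}}\varphi_{\mathcal{O}}$ defines an isomorphism between the vector space of complex sequences $(c_{\mathcal{O}})_{\mathcal{O}}$ indexed by the set of conjugacy classes of $W$ and the vector space of tracial functionals on $\mathcal{H}$.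
   Context: A Coxeter system $(W,S)$ ($S$ finite) is right-angled if $m_{st}=\mathrm{ord}(st)\in\{1,2,\infty\}$ for all $s,t\in S$. $|w|$ denotes word length with respect to $S$. The Iwahori-Hecke algebra $\mathbb{C}(W,S,q)$ is the unital complex algebra with vector space basis $(T_w)_{w\in W}$ and multiplication determined by, for $s\in S$, $w\in W$: $T_sT_w=T_{sw}$ if $|sw|>|w|$ and $T_sT_w=p_sT_w+T_{sw}$ if $|sw|<|w|$, where $p_s=q_s^{1/2}-q_s^{-1/2}$. A trace (tracial functional) on $\mathcal{H}$ is a linear functional $\tau\colon\mathcal{H}\to\mathbb{C}$ with $\tau(ab)=\tau(ba)$ for all $a,b\in\mathcal{H}$. The (possibly infinite) sum in (2) is taken pointwise on $\mathcal{H}$; $\mathbb{1}_{\mathcal{O}}$ is the indicator function of $\mathcal{O}$. *)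

(* Defs.v *)
From HB Require Import structures.
From mathcomp Require Import all_boot all_order all_algebra finmap complex.
From mathcomp Require Import all_classical all_reals.

Set Implicit Arguments.
Unset Strict Implicit.
Unset Printing Implicit Defensive.

Import Order.TTheory GRing.Theory Num.Theory.

Local Open Scope classical_set_scope.
Local Open Scope ring_scope.

(* The order of g, with 0 standing for an infinite order; in particular
   g ^+ ord g = 1 always holds. *)
Definition ord (W : groupType) (g : W) : nat :=
  xget 0%N [set n | [/\ (0 < n)%N, (g ^+ n = 1)%g
                      & forall m, (0 < m)%N -> (g ^+ m = 1)%g -> (n <= m)%N]].

Section Coxeter.
Variables (W : groupType) (S : {fset W}).

Definition eval (u : seq S) : W := (\prod_(s <- u) val s)%g.

(* The congruence on words generated by the relations (s t)^{m_st} = 1 with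
   m_st = ord (s t) finite: if m_st is infinite, ord is 0 and the relator is
   the empty word.  For involutions, m_ss = 1 makes the relator at t = s the
   word s s, so the quotient of the free monoid on S by this congruence is
   already the group with generators S and these relations. *)
Inductive cox_cong : seq S -> seq S -> Prop :=
| cox_refl u : cox_cong u u
| cox_sym u v : cox_cong u v -> cox_cong v u
| cox_trans u v w : cox_cong u v -> cox_cong v w -> cox_cong u w
| cox_rel u v (s t : S) :
    cox_cong (u ++ flatten (nseq (ord (val s * val t)%g) [:: s; t]) ++ v)
             (u ++ v).

(* W is presented by < S | (s t)^{m_st} = 1 >. *)
Definition coxeter_system : Prop :=
  [/\ forall s : S, ord (val s) = 2%N,
      forall w : W, exists u : seq S, eval u = w
    & forall u v : seq S, eval u = eval v -> cox_cong u v].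

Definition right_angled : Prop :=
  forall s t : S, ord (val s * val t)%g \in [:: 1; 2; 0]%N.

Definition len (w : W) : nat :=
  xget 0%N [set n | (exists2 u : seq S, eval u = w & size u = n) /\
                    (forall u : seq S, eval u = w -> (n <= size u)%N)].

Definition min_len_in_class (w : W) : Prop :=
  forall g : W, (len w <= len (w ^ g)%g)%N.

End Coxeter.

Definition conj_classes (W : groupType) : set (set W) :=
  [set O | exists w : W, O = [set (w ^ g)%g | g in [set: W]]].
Arguments conj_classes W : clear implicits.

Section Hecke.
Variables (R : realType) (W : groupType) (S : {fset W}) (q : S -> R).
Variables (H : algType R[i]) (T : W -> H).

Definition is_basis : Prop :=
  (forall h : H, exists (r : seq W) (c : W -> R[i]),
      h = \sum_(w <- r) c w *: T w) /\
  (forall (r : seq W) (c : W -> R[i]), uniq r ->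
      \sum_(w <- r) c w *: T w = 0 -> forall w, w \in r -> c w = 0).

Definition hecke_p (s : S) : R[i] :=
  (Num.sqrt (q s) - (Num.sqrt (q s))^-1)%:C%C.

(* H, with the family T, is the Iwahori-Hecke algebra C(W, S, q); these
   conditions determine the pair (H, T) up to a unique isomorphism. *)
Definition iwahori_hecke : Prop :=
  [/\ is_basis,
      T 1%g = 1,
      forall (s : S) (w : W), (len S w < len S (val s * w)%g)%N ->
        T (val s) * T w = T (val s * w)%g
    & forall (s : S) (w : W), (len S (val s * w)%g < len S w)%N ->
        T (val s) * T w = hecke_p s *: T w + T (val s * w)%g].

Definition is_trace (tau : H -> R[i]) : Prop :=
  scalar tau /\ forall a b : H, tau (a * b) = tau (b * a).

Definition class_trace (O : set W) (phi : H -> R[i]) : Prop :=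
  is_trace phi /\
  forall w : W, min_len_in_class S w -> phi (T w) = (w \in O)%:R.

End Hecke.

(* The pointwise sum of the c_O phi_O.  The operator \sum_(O \in A) is the
   sum over the support when the latter is finite, and 0 otherwise. *)
Definition class_sum (R : realType) (W : groupType) (H : algType R[i])
    (phi : conj_classes W -> H -> R[i]) (c : conj_classes W -> R[i]^o) :
    H -> R[i]^o :=
  fun h => \sum_(O \in [set: conj_classes W]) (c O * phi O h : R[i]).

(* Main.v *)
Require Import Defs.
From HB Require Import structures.
From mathcomp Require Import all_boot all_order all_algebra finmap complex ring.
From mathcomp Require Import all_classical all_reals.

Set Implicit Arguments.
Unset Strict Implicit.
Unset Printing Implicit Defensive.

Import Order.TTheory GRing.Theory Num.Theory.

Local Open Scope classical_set_scope.
Local Open Scope ring_scope.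

(** Write b_s = p_s / 2 and a_s = (q_s^(1/2) + q_s^(-1/2)) / 2, so that
    a_s^2 = 1 + b_s^2.  The quadratic relation T_s^2 = 1 + p_s T_s then says
    that u_s = (T_s - b_s) / a_s is an involution, and u_s, u_t commute when s, t
    do.  Since W is right-angled, these are all the defining relations of W, so
    s |-> u_s extends to a homomorphism w |-> U_w (group_elt) from W to the units
    of H.  By T_triangular each T_w is a nonzero multiple of U_w modulo the U_v
    with |v| < |w|; hence (U_w) is a basis, H is the group algebra of W in
    disguise, and traces on H are the same as class functions on W
    (trace_class_function).

    It remains to read a trace off its values on the T_w.  Choose in each
    conjugacy class a representative of minimal length, and let rep w be the one
    of the class of w.  The family that consists of T_w when w = rep w and of
    U_w - U_(rep w) otherwise is still unitriangular up to scalars, hence a basis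
    (adapted_basis).  A functional is a trace exactly when it kills the second
    kind of vectors, so a trace is given by arbitrary values on the T_(rep w).

    Finally, these values determine those on every w of minimal length in its
    class, because a trace takes one value on all T_w with w of minimal length in
    a given class (trace_conj_min).  This is where the combinatorics of W enters.
    If w and w^g are both of minimal length, then either a letter s that can
    be moved to the front of g cancels at one end of w or commutes with w, and
    conjugation by s is a cyclic shift or trivial; or no letter does, and then
    g^-1 w g is a reduced product, which is too long unless g = 1 (red_conj).  The
    solution of the word problem behind this is the normal form nf: W acts on
    reduced words modulo commutations by cancelling or adding a letter in front. *)

(** * Words up to commutation *)

Section Words.
Variables (A : eqType) (c : rel A).
Hypotheses (c_sym : symmetric c) (c_irr : irreflexive c).
Implicit Types (s t a b : A) (u v x y : seq A).

(** The letter s can be brought to the front of u by commutations of adjacent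
    letters. *)
Fixpoint front s u : bool :=
  if u is t :: u' then (t == s) || c s t && front s u' else false.

(** No two equal letters of u can be made adjacent by commutations. *)
Fixpoint red u : bool :=
  if u is s :: u' then ~~ front s u' && red u' else true.

(** Equality up to commutations of adjacent letters.  Such an equality only has to
    be checked on the projections to pairs of letters that do not commute (with
    a = b allowed), and in this form it needs no induction on a sequence of
    swaps. *)
Definition heap_eq u v : Prop :=
  forall a b, ~~ c a b -> seq.filter (pred2 a b) u = seq.filter (pred2 a b) v.

(** Left multiplication by a generator s, on reduced words.  When s can be moved
    to the front, the occurrence that moves is the first one, so rem deletes the
    right letter. *)
Definition act s u : seq A := if front s u then rem s u else s :: u.

Definition nf u : seq A := foldr act [::] u.

Lemma heap_eq_refl u : heap_eq u u.
Proof. by []. Qed.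

Lemma heap_eq_sym u v : heap_eq u v -> heap_eq v u.
Proof. by move=> h a b /h. Qed.

Lemma heap_eq_trans v u x : heap_eq u v -> heap_eq v x -> heap_eq u x.
Proof. by move=> h k a b cab; rewrite h ?k. Qed.

Lemma heap_eq_cons s u v : heap_eq u v -> heap_eq (s :: u) (s :: v).
Proof. by move=> h a b /h /= ->. Qed.

Lemma heap_eq_size u v : heap_eq u v -> size u = size v.
Proof.
move=> h; apply/perm_size/allP => a _; apply/eqP.
have := congr1 size (h a a (negbT (c_irr a))); rewrite !size_filter.
by rewrite !(eq_count (a2 := pred1 a)) // => b; rewrite /= orbb.
Qed.

Lemma filter_rem (p : pred A) s u :
  seq.filter p (rem s u) = if p s then rem s (seq.filter p u) else seq.filter p u.
Proof.
elim: u => [|t u IH] /=; first by case: ifP.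
have [->|nts] := eqVneq t s.
  by case: (p s) => //=; rewrite eqxx.
by rewrite /= IH; case: (p s); case: (p t) => //=; rewrite (negPf nts).
Qed.

Lemma heap_eq_rem s u v : heap_eq u v -> heap_eq (rem s u) (rem s v).
Proof. by move=> h a b cab; rewrite !filter_rem h. Qed.

(** This describes front in terms of the projections alone, so that it is
    invariant under heap_eq. The case b = s says that s occurs in u. *)
Lemma frontP s u : front s u <->
  forall b, ~~ c s b -> ohead (seq.filter (pred2 s b) u) = Some s.
Proof.
elim: u => [|t u IH] /=.
  by split=> // /(_ s (negbT (c_irr s))).
have [->|nts] := eqVneq t s; first by [].
case cst: (c s t) => /=.
  rewrite IH; split=> h b csb; have := h b csb.
    by case: eqVneq csb => // <-; rewrite cst.
  by case: eqVneq csb => // <-; rewrite cst.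
by split=> // /(_ t (negbT cst)); rewrite eqxx /= => -[] /eqP; rewrite (negPf nts).
Qed.

Lemma heap_eq_front s u v : heap_eq u v -> front s u = front s v.
Proof.
move=> h; apply/idP/idP => /frontP k; apply/frontP => b csb.
  by rewrite -h ?k.
by rewrite h ?k.
Qed.

Lemma front_mem s u : front s u -> s \in u.
Proof.
elim: u => //= t u IH /orP[/eqP->|/andP[_ /IH su]]; rewrite inE ?eqxx //.
by rewrite su orbT.
Qed.

Lemma heap_eq_front_rem s u : front s u -> heap_eq u (s :: rem s u).
Proof.
move=> /frontP h a b cab; rewrite /= filter_rem /=.
have filterC : seq.filter (pred2 a b) u = seq.filter (pred2 b a) u.
  by apply: eq_filter => t /=; rewrite orbC.
have pop v : ohead v = Some s -> v = s :: rem s v.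
  by case: v => //= t v [->]; rewrite eqxx.
case: (eqVneq s a) => /= [<-|nsa] in cab *; first exact/pop/h.
case: (eqVneq s b) => // sb in cab *; rewrite filterC -sb; apply/pop/h.
by rewrite sb c_sym.
Qed.

Lemma heap_eq_act s u v : heap_eq u v -> heap_eq (act s u) (act s v).
Proof.
move=> h; rewrite /act (heap_eq_front s h).
by case: ifP => _; [apply: heap_eq_rem | apply: heap_eq_cons].
Qed.

Lemma heap_eq_foldr_act x u v :
  heap_eq u v -> heap_eq (foldr act u x) (foldr act v x).
Proof. by elim: x => //= s x IH /IH; apply: heap_eq_act. Qed.

Lemma heap_eq_swap s t u : c s t -> heap_eq (s :: t :: u) (t :: s :: u).
Proof.
move=> cst a b cab /=; case: ifP => // psab; case: ifP => // ptab.
move: psab ptab cab cst => /orP[] /eqP-> /orP[] /eqP->; rewrite ?c_irr // => /negPf.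
  by move=> ->.
by rewrite c_sym => ->.
Qed.

Lemma front_rem_comm s t u : c s t -> front t u -> front s (rem t u) = front s u.
Proof.
move=> cst /heap_eq_front_rem /heap_eq_front->; rewrite /= cst.
by case: eqVneq cst => // ->; rewrite c_irr.
Qed.

Lemma front_act_comm s t u : c s t -> front s (act t u) = front s u.
Proof.
move=> cst; rewrite /act; case: ifP => ftu; first exact: front_rem_comm.
by rewrite /= cst; case: eqVneq cst => // ->; rewrite c_irr.
Qed.

Lemma rem_comm s t u : rem s (rem t u) = rem t (rem s u).
Proof.
elim: u => //= a u IH.
have [at_|nat_] := eqVneq a t; have [as_|nas] := eqVneq a s => //=.
- by rewrite -at_ as_.
- by rewrite at_ eqxx.
- by rewrite as_ eqxx.
- by rewrite (negPf nat_) (negPf nas) IH.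
Qed.

(** For commuting s and t, the letter t affects neither whether s can reach the
    front nor which occurrence does. *)
Lemma act_comm s t u : c s t -> heap_eq (act s (act t u)) (act t (act s u)).
Proof.
move=> cst; have cts : c t s by rewrite c_sym.
have nst : s != t by apply: contraTneq cst => ->; rewrite c_irr.
rewrite {1}/act (front_act_comm _ cst) [act t (act s u)]/act (front_act_comm _ cts).
rewrite /act; case: (front s u); case: (front t u) => /=.
- by rewrite rem_comm.
- by rewrite eq_sym (negPf nst).
- by rewrite (negPf nst).
- exact: heap_eq_swap.
Qed.

(** After s has been pulled out of a reduced word, no second s can reach the
    front: the two would have cancelled. This makes act s an involution. *)
Lemma red_rem s u : red u -> front s u -> red (rem s u) && ~~ front s (rem s u).
Proof.
elim: u => //= t u IH /andP[nft ru]; have [<-|nts] := eqVneq t s.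
  by rewrite ru nft.
case/andP=> cst fsu; rewrite /= cst (negPf nts) /=.
have /andP[-> ->] := IH ru fsu.
by rewrite andbT front_rem_comm // 1?c_sym // nft.
Qed.

Lemma red_act s u : red u -> red (act s u).
Proof.
move=> ru; rewrite /act; case: ifP => fs /=; last by rewrite fs.
by case/andP: (red_rem ru fs).
Qed.

Lemma actK s u : red u -> heap_eq (act s (act s u)) u.
Proof.
move=> ru; rewrite {2}/act; case: ifP => fs.
  have /andP[_ /negPf nf_] := red_rem ru fs.
  by rewrite /act nf_; apply/heap_eq_sym/heap_eq_front_rem.
by rewrite /act /= eqxx.
Qed.

Lemma red_nf u : red (nf u).
Proof. by elim: u => //= s u; apply: red_act. Qed.

Lemma nf_red u : red u -> nf u = u.
Proof. by elim: u => //= s u IH /andP[nfs ru]; rewrite IH // /act (negPf nfs). Qed.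

Lemma size_act s u : (size (act s u) <= (size u).+1)%N.
Proof.
rewrite /act; case: ifP => // /front_mem su; rewrite size_rem //.
by rewrite (leq_trans (leq_pred _)).
Qed.

Lemma size_nf u : (size (nf u) <= size u)%N.
Proof. by elim: u => //= s u IH; apply: leq_trans (size_act _ _) _. Qed.

(** Each cancellation during normalisation costs two letters, so a word whose
    normal form has full length has met none. *)
Lemma size_nf_red u : size (nf u) = size u -> red u.
Proof.
elim: u => //= s u IH; rewrite /act; case: ifP => fs.
  have := size_nf u; have := front_mem fs; case: (nf u) fs => // t v fs si.
  rewrite size_rem //= => le1 e; move: le1; rewrite e => /ltnW.
  by rewrite ltnn.
move=> /= [e]; have ru := IH e; rewrite ru andbT.
by rewrite nf_red in fs; rewrite ?fs.
Qed.

Lemma front_cat s x y : front s (x ++ y) = front s x || all (c s) x && front s y.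
Proof. by elim: x => //= t x ->; case: (t == s); case: (c s t). Qed.

(** A cancellation in a product of two reduced words pairs a letter that reaches
    the end of x with the same letter reaching the front of y. *)
Lemma red_cat x y : red x -> red y ->
  (forall s, front s (rev x) -> front s y -> False) -> red (x ++ y).
Proof.
elim: x => //= s x IH /andP[nfs rx] ry h; rewrite IH //.
  rewrite andbT front_cat negb_or nfs /=; apply/negP => /andP[cx fy].
  by apply: (h s _ fy); rewrite rev_cons -cats1 front_cat all_rev cx /= eqxx orbT.
by move=> t ft; apply: h; rewrite rev_cons -cats1 front_cat ft.
Qed.

Lemma red_rev x : red x -> red (rev x).
Proof.
elim: x => //= s x IH /andP[nfs rx]; rewrite rev_cons -cats1.
apply: red_cat => //=; first exact: IH.
move=> t; rewrite revK andbF orbF => ft /eqP st; by rewrite st ft in nfs.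
Qed.

(** A letter s that cancels between rev g and u ++ g is at the front of g, and it
    is either at the front of u or commutes with all of u and meets its own
    copy in g.  A letter that cancels between u and g is at the end of u and at the
    front of g.  The hypothesis excludes all of these cases. *)
Lemma red_conj g u : red g -> red u ->
  (forall s, front s g -> ~~ front s u && ~~ front s (rev u) && ~~ all (c s) u) ->
  red (rev g ++ u ++ g).
Proof.
move=> rg ru h; apply: red_cat; first exact: red_rev.
  by apply: red_cat => // s fu /h /andP[/andP[_ /negP]].
move=> s; rewrite revK front_cat => /h /andP[/andP[/negPf-> _] /negPf->]; by [].
Qed.

End Words.

(** * Lengths in a right-angled Coxeter group *)

(** A nonzero value of ord is the true order, the default value being 0. *)
Lemma ordP (W : groupType) (g : W) n : ord g = n.+1 ->
  (g ^+ n.+1 = 1)%g /\ forall m, (0 < m)%N -> (g ^+ m = 1)%g -> (n < m)%N.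
Proof. by rewrite /ord; case: xgetP => // _ -> [_ g1 gm] e; rewrite e in g1 gm. Qed.

Section RightAngled.
Variables (W : groupType) (S : {fset W}).
Hypotheses (hW : coxeter_system S) (hra : right_angled S).
Implicit Types (s t : S) (u v x y : seq S) (w g : W).
Local Notation len := (len S).

Definition scomm s t : bool :=
  (s != t) && (val s * val t == val t * val s)%g.

Lemma scomm_sym : symmetric scomm.
Proof. by move=> s t; rewrite /scomm eq_sym [X in _ && X]eq_sym. Qed.

Lemma scomm_irr : irreflexive scomm.
Proof. by move=> s; rewrite /scomm eqxx. Qed.

Local Notation front := (front scomm).
Local Notation red := (red scomm).
Local Notation act := (act scomm).
Local Notation nf := (nf scomm).
Local Notation heap_eq := (heap_eq scomm).

Lemma gen_sq s : (val s * val s = 1)%g.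
Proof. by case: hW => /(_ s) /ordP[]. Qed.

Lemma genV s : ((val s)^-1 = val s)%g.
Proof. exact/mulg1_eq/gen_sq. Qed.

Lemma eval_nil : eval ([::] : seq S) = 1%g.
Proof. by rewrite /eval big_nil. Qed.

Lemma eval_cons s u : eval (s :: u) = (val s * eval u)%g.
Proof. by rewrite /eval big_cons. Qed.

Lemma eval_cat u v : eval (u ++ v) = (eval u * eval v)%g.
Proof. by rewrite /eval big_cat. Qed.

Lemma eval_rev u : eval (rev u) = (eval u)^-1%g.
Proof.
elim: u => [|s u IH]; first by rewrite eval_nil invg1.
by rewrite rev_cons -cats1 eval_cat !eval_cons eval_nil mulg1 invgM IH genV.
Qed.

Lemma eval_comm s u : all (scomm s) u -> (val s * eval u = eval u * val s)%g.
Proof.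
elim: u => [|t u IH] /=; first by rewrite eval_nil mulg1 mul1g.
case/andP=> /andP[_ /eqP cst] /IH e.
by rewrite eval_cons mulgA cst -mulgA e mulgA.
Qed.

Lemma eval_front s u : front s u -> eval u = (val s * eval (rem s u))%g.
Proof.
elim: u => //= t u IH; have [-> _|nts] := eqVneq t s; first by rewrite eval_cons.
case/andP=> /andP[_ /eqP cst] /IH e.
by rewrite !eval_cons e !mulgA cst.
Qed.

Lemma eval_act s u : eval (act s u) = (val s * eval u)%g.
Proof.
rewrite /act; case: ifP => [/eval_front->|_]; last exact: eval_cons.
by rewrite mulgA gen_sq mul1g.
Qed.

Lemma eval_nf u : eval (nf u) = eval u.
Proof. by elim: u => //= s u IH; rewrite eval_act eval_cons IH. Qed.

Lemma ord1_eq s t : ord (val s * val t)%g = 1%N -> t = s.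
Proof.
by move=> /ordP[]; rewrite expg1 => /mulg1_eq e _; apply/val_inj; rewrite /= -e genV.
Qed.

Lemma ord2_scomm s t : ord (val s * val t)%g = 2%N -> scomm s t.
Proof.
move=> /ordP[st2 st2m]; apply/andP; split.
  by apply/eqP => st; have := st2m 1%N isT; rewrite expg1 st gen_sq => /(_ erefl).
by rewrite -[X in _ == X]invgK invgM !genV (mulg1_eq st2).
Qed.

(** The relators of a right-angled group act trivially on reduced words: they are
    ss, stst with commuting s and t, or empty. So the action of words descends
    to W. *)
Lemma act_relator s t x : red x ->
  heap_eq (foldr act x (flatten (nseq (ord (val s * val t)%g) [:: s; t]))) x.
Proof.
move=> rx; have aK := actK scomm_sym scomm_irr.
have rA := red_act scomm_sym scomm_irr.
have hA := heap_eq_act scomm_irr.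
have hT := @heap_eq_trans _ scomm.
have := hra s t; rewrite !inE => /or3P[] /eqP e; rewrite e /=.
- by rewrite (ord1_eq e); apply: aK.
- have ac := act_comm scomm_sym scomm_irr _ (ord2_scomm e).
  apply: (hT _ _ _ _ (aK s x rx)); apply: (hA).
  apply: (hT _ _ _ (hA _ _ _ (ac _))); exact/aK/rA.
- exact: heap_eq_refl.
Qed.

Lemma nf_cong u v : cox_cong u v -> heap_eq (nf u) (nf v).
Proof.
elim=> {u v} [u|u v _|u v x _ h1 _ h2|u v s t].
- exact: heap_eq_refl.
- exact: heap_eq_sym.
- exact: heap_eq_trans h1 h2.
rewrite /nf !foldr_cat; apply: (heap_eq_foldr_act scomm_irr).
exact/act_relator/(red_nf scomm_sym scomm_irr).
Qed.

(** Words with the same value have normal forms that differ only by commutations,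
    hence of the same size; and normalising never lengthens a word. *)
Lemma len_eval u : len (eval u) = size (nf u).
Proof.
rewrite /Defs.len; apply: xget_unique.
  split; first by exists (nf u); rewrite ?eval_nf.
  move=> v vu; case: hW => _ _ /(_ _ _ vu) /nf_cong.
  move=> /(heap_eq_size scomm_irr) <-; exact: size_nf.
move=> n [[v vu <-] h]; apply/eqP; rewrite eqn_leq; apply/andP; split.
  by apply: h; rewrite eval_nf.
case: hW => _ _ /(_ _ _ vu) /nf_cong.
by move=> /(heap_eq_size scomm_irr) <-; exact: size_nf.
Qed.

Lemma len_red u : red u -> len (eval u) = size u.
Proof. by move=> ru; rewrite len_eval nf_red. Qed.

Lemma red_len u : len (eval u) = size u -> red u.
Proof. by rewrite len_eval; apply: size_nf_red. Qed.

Lemma len_eval_le u : (len (eval u) <= size u)%N.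
Proof. by rewrite len_eval size_nf. Qed.

Lemma red_word w : exists2 u, red u & eval u = w.
Proof.
case: hW => _ /(_ w) [u <-] _; exists (nf u); last exact: eval_nf.
exact: (red_nf scomm_sym scomm_irr).
Qed.

Lemma len1 : len 1%g = 0%N.
Proof. by rewrite -eval_nil len_eval. Qed.

Lemma len_gen s : len (val s) = 1%N.
Proof. by rewrite -[val s]mulg1 -eval_nil -eval_cons len_red. Qed.

Lemma lenM w g : (len (w * g)%g <= len w + len g)%N.
Proof.
have [u ru <-] := red_word w; have [v rv <-] := red_word g.
by rewrite -eval_cat (leq_trans (len_eval_le _)) // size_cat !len_red.
Qed.

Lemma len_gen2 s t : s != t -> len (val s * val t)%g = 2%N.
Proof.
move=> nst; rewrite -[val t]mulg1 -eval_nil -!eval_cons len_red //=.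
by rewrite andbF orbF andbT eq_sym.
Qed.

End RightAngled.

(** * Triangular changes of basis *)

Section Span.
Variables (F : fieldType) (I : choiceType) (V : lmodType F).
Implicit Types (B : I -> V) (P : I -> Prop) (h k : V).

(** The span as an inductive predicate: membership is then proved and used by
    induction, without manipulating families of coefficients. *)
Inductive in_span B P : V -> Prop :=
| in_span0 : in_span B P 0
| in_spanDZ a i h : P i -> in_span B P h -> in_span B P (a *: B i + h).

Lemma in_spanD B P h k : in_span B P h -> in_span B P k -> in_span B P (h + k).
Proof.
move=> sh sk; elim: sh => {h} [|a i h Pi _ IH]; first by rewrite add0r.
by rewrite -addrA; apply: in_spanDZ.
Qed.

Lemma in_spanZ B P a h : in_span B P h -> in_span B P (a *: h).
Proof.
elim=> {h} [|b i h Pi _ IH]; first by rewrite scaler0; apply: in_span0.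
by rewrite scalerDr scalerA; apply: in_spanDZ.
Qed.

Lemma in_span_gen B P i : P i -> in_span B P (B i).
Proof.
move=> Pi; rewrite -[B i]addr0 -[B i]scale1r.
by apply: in_spanDZ => //; apply: in_span0.
Qed.

Lemma in_spanN B P h : in_span B P h -> in_span B P (- h).
Proof. by rewrite -scaleN1r; apply: in_spanZ. Qed.

Lemma in_spanB B P h k : in_span B P h -> in_span B P k -> in_span B P (h - k).
Proof. by move=> sh sk; apply: in_spanD => //; apply: in_spanN. Qed.

Lemma in_span_sum B P (r : seq I) (c : I -> F) :
  (forall i, i \in r -> P i) -> in_span B P (\sum_(i <- r) c i *: B i).
Proof.
move=> h; rewrite big_seq; elim/big_ind: _ => [||i ir].
- exact: in_span0.
- exact: in_spanD.
- exact/in_spanZ/in_span_gen/h.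
Qed.

(** The terms with a common index are collected; this is the form in which
    linear independence can be applied. *)
Lemma in_span_uniq B P h : in_span B P h -> exists r : seq I, exists c : I -> F,
  [/\ uniq r, forall i, i \in r -> P i & h = \sum_(i <- r) c i *: B i].
Proof.
elim=> {h} [|a i h Pi _ [r [c [ur hr ->]]]].
  by exists [::], (fun=> 0); rewrite big_nil.
pose c0 j := if j \in r then c j else 0.
have cE : \sum_(j <- r) c j *: B j = \sum_(j <- r) c0 j *: B j.
  by apply: eq_big_seq => j jr; rewrite /c0 jr.
exists (i :: rem i r), (fun j => if j == i then a + c0 i else c j); split=> /=.
- by rewrite mem_rem_uniqF // rem_uniq.
- by move=> j; rewrite inE => /orP[/eqP->|/mem_rem /hr].
rewrite big_cons eqxx scalerDl -addrA; congr (_ + _).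
have -> : \sum_(j <- rem i r) (if j == i then a + c0 i else c j) *: B j =
          \sum_(j <- rem i r) c j *: B j.
  apply: eq_big_seq => j; rewrite mem_rem_uniq // inE /= => /andP[/negPf->] //.
rewrite /c0; case: ifP => ir; last by rewrite rem_id ?ir // scale0r add0r.
by rewrite (perm_big _ (perm_to_rem ir)) big_cons.
Qed.

Lemma in_span_mono B P (Q : I -> Prop) h :
  (forall i, P i -> Q i) -> in_span B P h -> in_span B Q h.
Proof.
move=> PQ; elim=> {h} [|a i h /PQ Qi _ IH]; first exact: in_span0.
exact: in_spanDZ.
Qed.

Definition free_family B : Prop := forall (r : seq I) (c : I -> F), uniq r ->
  \sum_(i <- r) c i *: B i = 0 -> forall i, i \in r -> c i = 0.

Definition basis B : Prop := (forall h, in_span B xpredT h) /\ free_family B.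

(** Up to the nonzero diagonal coefficients, B' is obtained from B by a matrix that
    is unitriangular for the rank rk; several indices may have the same rank. *)
Definition triangular (rk : I -> nat) B (B' : I -> V) : Prop :=
  forall i, exists2 a : F, a != 0 &
    in_span B (fun j => (rk j < rk i)%N) (B' i - a *: B i).

End Span.

Lemma linear_at0 (F : fieldType) (V V' : lmodType F) (f : V -> V') :
  linear f -> f 0 = 0.
Proof. by move/(_ (-1) 0 0); rewrite scaler0 addr0 scaleN1r addNr. Qed.

Lemma in_span_lin (F : fieldType) (I J : choiceType) (V V' : lmodType F)
    (f : V -> V') (B : I -> V) (P : I -> Prop) (B' : J -> V') (Q : J -> Prop) :
  linear f -> (forall i, P i -> in_span B' Q (f (B i))) ->
  forall h, in_span B P h -> in_span B' Q (f h).
Proof.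
move=> lf fB h; elim=> {h} [|a i h Pi _ IH].
  by rewrite linear_at0 //; apply: in_span0.
by rewrite lf; apply: in_spanD => //; apply/in_spanZ/fB.
Qed.

Section Basis.
Variables (F : fieldType) (I : choiceType) (V : lmodType F).
Implicit Types (B : I -> V) (P : I -> Prop).

Lemma linear_span_eq (V' : lmodType F) (f g : V -> V') B P :
  linear f -> linear g -> (forall i, P i -> f (B i) = g (B i)) ->
  forall h, in_span B P h -> f h = g h.
Proof.
move=> lf lg e h; elim=> {h} [|a i h Pi _ IH].
  by rewrite !linear_at0.
by rewrite lf lg e // IH.
Qed.

(** The graph of the functional is the span of the pairs (B i, g i) in V * F: it
    projects onto V because B spans, and injectively because B is free. *)
Lemma basis_functional B (g : I -> F) : basis B ->
  exists f : V -> F^o, linear f /\ forall i, f (B i) = g i.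
Proof.
case=> sB fB; pose G i : V * F^o := (B i, g i).
have tot h : exists y, in_span G xpredT (h, y).
  elim: (sB h) => {h} [|a i h _ _ [y hy]]; first by exists 0; apply: in_span0.
  by exists (a * g i + y); apply: (in_spanDZ a (i := i) _ hy).
(* The graph meets the vertical axis only in 0, hence is a function. *)
have sep y : in_span G xpredT (0, y) -> y = 0.
  case/in_span_uniq => r [c [ur _ e]].
  have /= e1 := congr1 fst e; have /= -> := congr1 snd e.
  rewrite raddf_sum /= in e1; rewrite raddf_sum /= big_seq big1 // => i ir.
  by rewrite (fB r c ur _ i ir) ?scale0r.
have [f fP] := choice tot.
have fun_ h y : in_span G xpredT (h, y) -> f h = y.
  move=> hy; apply/eqP; rewrite -subr_eq0; apply/eqP/sep.
  by rewrite -(subrr h); apply: (in_spanB (fP h) hy).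
exists f; split=> [a u v|i]; apply: fun_; last exact: (in_span_gen G (i := i)).
exact: (in_spanD (in_spanZ a (fP u)) (fP v)).
Qed.

Variable rk : I -> nat.

(** By induction on the rank, the terms of lower rank in the expansion of B' i can
    be rewritten in terms of B', and the relation is solved for B i. *)
Lemma triangular_sym B B' : triangular rk B B' -> triangular rk B' B.
Proof.
move=> tri i; have [n] := ubnP (rk i); elim: n i => // n IH i lein.
have [a a0 s] := tri i; exists a^-1; first by rewrite invr_eq0.
have -> : B i - a^-1 *: B' i = - (a^-1 *: (B' i - a *: B i)).
  by rewrite scalerBr scalerA mulVf // scale1r opprB.
apply/in_spanN/in_spanZ; elim: s => [|b j h ji _ IHh]; first exact: in_span0.
apply: in_spanD IHh; apply: in_spanZ.
have [b' _ sj] := IH j (leq_trans ji lein).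
rewrite -[B j](subrK (b' *: B' j)); apply: in_spanD.
  by apply: in_span_mono sj => k /ltn_trans; apply.
exact/in_spanZ/in_span_gen.
Qed.

Lemma triangular_span B B' : triangular rk B B' ->
  (forall h, in_span B xpredT h) -> forall h, in_span B' xpredT h.
Proof.
move=> /triangular_sym tri sB h.
apply: (in_span_lin (f := idfun)) (sB h) => // i _ /=.
have [a _ s] := tri i; rewrite -[B i](subrK (a *: B' i)).
apply: in_spanD; last exact/in_spanZ/in_span_gen.
exact: in_span_mono s.
Qed.

(** In a vanishing combination of the B' i, the coordinate of B at an index of
    maximal rank sees only the diagonal term of that index. *)
Lemma triangular_basis B B' : triangular rk B B' -> basis B -> basis B'.
Proof.
move=> tri bB; split; first by case: bB => sB _; apply: triangular_span tri sB.
move=> r c ur c0; pose N := \max_(i <- r) rk i.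
(* Descending induction on the rank, counted down from its maximum N. *)
suff all0 n i : i \in r -> (N - rk i < n)%N -> c i = 0.
  by move=> i ir; apply: (all0 (N - rk i).+1).
elim: n i => // n IH i ir le.
have [e [le_ eB]] := basis_functional (fun j => (j == i)%:R) bB.
pose E : {linear V -> F^o} := HB.pack e (GRing.isLinear.Build _ _ _ _ e le_).
have eE h : E h = e h by [].
have low j : (rk j <= rk i)%N -> exists a, e (B' j) = a * (j == i)%:R /\ a != 0.
  move=> ji; have [a a0 s] := tri j; exists a; split=> //.
  have s0 : E (B' j - a *: B j) = 0.
    apply: (linear_span_eq (g := fun=> 0) le_) s.
      by move=> b x y /=; rewrite [RHS]addr0 [RHS]scaler0.
    move=> k kj; rewrite eB; case: eqP => // ki; move: kj.
    by rewrite ki ltnNge ji.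
  by rewrite -[B' j](subrK (a *: B j)) -eE linearD s0 add0r linearZ /= eB.
have := congr1 E c0; rewrite linear0 linear_sum.
rewrite (bigD1_seq i) // big_seq_cond big1 => [|j /andP[jr nji]].
  have [a [ea a0]] := low i (leqnn _).
  rewrite [LHS]addr0 linearZ /= ea eqxx mulr1 => /eqP.
  by rewrite mulf_eq0 (negPf a0) orbF => /eqP.
have [ji|ij] := leqP (rk j) (rk i).
  have [a [ea _]] := low j ji.
  by rewrite linearZ /= ea (negPf nji) mulr0 scaler0.
rewrite (IH j) ?scale0r ?linear0 //.
have jN : (rk j <= N)%N by rewrite /N; apply: (@leq_bigmax_seq _ r xpredT rk).
rewrite -ltnS; apply: leq_trans le; rewrite ltnS.
by apply: ltn_sub2l => //; apply: leq_trans jN.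
Qed.

End Basis.

(** * Traces at elements of minimal length *)

Section Hecke.
Variables (R : realType) (W : groupType) (S : {fset W}) (q : S -> R).
Variables (H : algType R[i]) (T : W -> H).
Hypotheses (hW : coxeter_system S) (hra : right_angled S).
Hypothesis (hT : iwahori_hecke q T).
Implicit Types (s t : S) (u v x y : seq S) (w g : W).
Local Notation len := (len S).
Local Notation scomm := (@scomm W S).
Local Notation front := (front scomm).
Local Notation red := (red scomm).

Lemma T_red u : red u -> T (eval u) = \prod_(s <- u) T (val s).
Proof.
case: hT => _ T1 Tup _; elim: u => [|s u IH] ru.
  by rewrite eval_nil big_nil.
have /andP[nfs ru'] := ru; rewrite big_cons -IH // eval_cons Tup //.
by rewrite -eval_cons !len_red.
Qed.

(** Concatenating reduced words of w and g gives a word of length |wg|, so it is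
    reduced as well. *)
Lemma T_mul w g : len (w * g)%g = (len w + len g)%N -> T (w * g)%g = T w * T g.
Proof.
have [u ru <-] := red_word hW w; have [v rv <-] := red_word hW g.
rewrite -eval_cat (len_red hW hra ru) (len_red hW hra rv) -size_cat.
by move=> /(red_len hW hra) ruv; rewrite !T_red // big_cat.
Qed.

Lemma trace_cyclic_shift (tau : H -> R[i]) w g : is_trace tau ->
  len (w * g)%g = (len w + len g)%N -> len (g * w)%g = len (w * g)%g ->
  tau (T (w * g)%g) = tau (T (g * w)%g).
Proof.
by move=> [_ tr] e1 e2; rewrite !T_mul // 1?e2 ?e1 1?addnC.
Qed.

Lemma min_len_conj w g : min_len_in_class S w ->
  (len (w ^ g)%g <= len w)%N -> min_len_in_class S (w ^ g)%g.
Proof. by move=> mw le h; rewrite -conjgM (leq_trans le). Qed.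

(** If s is at the front of u, then w = s w1 with |w1| < |w|, and w^s = w1 s is a
    cyclic shift of w; by minimality both products are reduced. The case where s
    is at the end is symmetric, and if s commutes with every letter of u then
    w^s = w. *)
Lemma trace_conj_gen (tau : H -> R[i]) u s : is_trace tau ->
  min_len_in_class S (eval u) -> red u ->
  [|| front s u, front s (rev u) | all (scomm s) u] ->
  (len (eval u ^ val s)%g <= len (eval u))%N /\
  tau (T (eval u ^ val s)%g) = tau (T (eval u)).
Proof.
move=> tr mw ru; set w := eval u; have ss := gen_sq hW s; have sV := genV hW s.
have wsE : (w ^ val s = val s * w * val s)%g by rewrite conjgE sV mulgA.
have ge : (len w <= len (val s * w * val s)%g)%N by rewrite -wsE.
case/or3P => [fs|fs|cs].
- pose w1 := eval (rem s u).
  have wE : w = (val s * w1)%g by rewrite /w (eval_front fs).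
  have e : (val s * w * val s = w1 * val s)%g by rewrite wE mulgA ss mul1g.
  have le1 : (len w1 < len w)%N.
    rewrite (len_red hW hra ru) (leq_ltn_trans (len_eval_le hW hra _)) //.
    by rewrite size_rem ?(front_mem fs) //; case: (u) (front_mem fs).
  have := lenM hW hra w1 (val s); rewrite (len_gen hW hra) addn1 => le2.
  have le3 := leq_trans le2 le1.
  have e1 : len (w1 * val s)%g = len w.
    by apply/eqP; rewrite eqn_leq le3 -e ge.
  have e2 : len w = (len w1).+1.
    by apply/eqP; rewrite eqn_leq le1 -e1 le2.
  rewrite wsE e e1 wE; split=> //; apply: trace_cyclic_shift => //.
    by rewrite e1 (len_gen hW hra) addn1.
  by rewrite e1 -wE.
- pose w1 := (w * val s)%g.
  have wE : w = (w1 * val s)%g by rewrite /w1 -mulgA ss mulg1.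
  have e : (val s * w * val s = val s * w1)%g by rewrite mulgA.
  have le1 : (len w1 < len w)%N.
    have -> : w1 = eval (rev (rem s (rev u))).
      rewrite eval_rev // /w1 /w -{1}[u]revK eval_rev // (eval_front fs).
      by rewrite invgM sV -mulgA ss mulg1.
    rewrite (len_red hW hra ru) (leq_ltn_trans (len_eval_le hW hra _)) //.
    rewrite size_rev size_rem ?(front_mem fs) // size_rev.
    by case: (u) fs.
  have := lenM hW hra (val s) w1; rewrite (len_gen hW hra) add1n => le2.
  have le3 := leq_trans le2 le1.
  have e1 : len (val s * w1)%g = len w.
    by apply/eqP; rewrite eqn_leq le3 -e ge.
  have e2 : len w = (len w1).+1.
    by apply/eqP; rewrite eqn_leq le1 -e1 le2.
  rewrite wsE e e1 [in RHS]wE; split=> //; apply: trace_cyclic_shift => //.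
    by rewrite e1 (len_gen hW hra) add1n.
  by rewrite e1 -wE.
- by rewrite wsE (eval_comm cs) -mulgA ss mulg1.
Qed.

(** Induction on the length of g. As long as some letter at the front of g cancels
    against w or commutes with it, it can be split off by the previous lemma;
    otherwise g^-1 w g is reduced and g = 1. *)
Lemma trace_conj_min (tau : H -> R[i]) w g : is_trace tau ->
  min_len_in_class S w -> (len (w ^ g)%g <= len w)%N ->
  tau (T (w ^ g)%g) = tau (T w).
Proof.
move=> tr; have [x rx <-] := red_word hW g.
have [n] := ubnP (size x); elim: n x rx w => // n IH x rx w lexn mw le.
have [u ru uw] := red_word hW w.
(* Either a letter at the front of g can be split off, or g^-1 w g is reduced. *)
have [|h] := pselect (exists2 s, front s x &
    [|| front s u, front s (rev u) | all (scomm s) u]).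
  case=> s fs cs; rewrite -uw in mw le *.
  have [le1 <-] := trace_conj_gen tr mw ru cs.
  rewrite (eval_front fs) conjgM in le *; have mw1 := min_len_conj mw le1.
  have /andP[rr _] := red_rem (@scomm_sym _ _) (@scomm_irr _ _) rx fs.
  apply: IH => //; last by rewrite (leq_trans le).
  by rewrite size_rem ?(front_mem fs) //; case: (x) fs lexn.
have : red (rev x ++ u ++ x).
  apply: red_conj => // s fs; rewrite -!negb_or; apply/negP => k.
  by apply: h; exists s => //; rewrite orbA.
move=> /(len_red hW hra); rewrite !eval_cat eval_rev // uw -conjgE => e.
move: le; rewrite e -uw (len_red hW hra ru) !size_cat size_rev.
case: (x) => [|s y] /=; first by rewrite eval_nil conjg1 => _; rewrite uw.
by rewrite addnCA -[leqRHS]addn0 leq_add2l.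
Qed.

(** * The group basis of the Hecke algebra *)

Hypothesis hq : forall s : S, 0 < q s.

(** T_s has the eigenvalues q_s^(1/2) and -q_s^(-1/2): half_sum is half their
    distance and half_diff their midpoint, so (T_s - half_diff) / half_sum has the
    eigenvalues 1 and -1. *)
Definition half_sum s : R[i] :=
  ((Num.sqrt (q s) + (Num.sqrt (q s))^-1) / 2)%:C%C.

Definition half_diff s : R[i] := hecke_p q s / 2.

Lemma half_sum_neq0 s : half_sum s != 0.
Proof.
have r0 : 0 < Num.sqrt (q s) by rewrite sqrtr_gt0.
rewrite /half_sum eq_complex /= negb_and; apply/orP; left.
by rewrite gt_eqF // divr_gt0 // addr_gt0 // invr_gt0.
Qed.

Lemma half_sum_sq s : half_sum s ^+ 2 = 1 + half_diff s ^+ 2.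
Proof.
have r0 : Num.sqrt (q s) != 0 by rewrite gt_eqF // sqrtr_gt0.
rewrite /half_sum /half_diff /hecke_p; set r := Num.sqrt (q s) in r0 *.
have two : (2 : R[i]) = 2%:R%:C%C by rewrite rmorph_nat.
rewrite two -fmorphV -rmorphM -!rmorphXn -(rmorph1 (real_complex R)) -rmorphD.
by congr (_%:C%C); field.
Qed.

Definition gen_unit s : H := (half_sum s)^-1 *: (T (val s) - (half_diff s)%:A).

Lemma T_gen s : T (val s) = half_sum s *: gen_unit s + (half_diff s)%:A.
Proof. by rewrite scalerA mulfV ?half_sum_neq0 // scale1r subrK. Qed.

Lemma T_gen_sq s : T (val s) * T (val s) = (half_diff s *+ 2) *: T (val s) + 1.
Proof.
case: hT => _ T1 _ Tdn; rewrite Tdn (gen_sq hW) ?len1 ?(len_gen hW hra) // T1.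
by rewrite -mulr_natr divfK // pnatr_eq0.
Qed.

Lemma gen_unit_sq s : gen_unit s * gen_unit s = 1.
Proof.
rewrite /gen_unit -scalerAl -scalerAr scalerA -invfM -expr2.
rewrite mulrBl !mulrBr T_gen_sq -!scalerAl -!scalerAr !mul1r !mulr1.
have -> : half_diff s *+ 2 *: T (\val s) + 1 - half_diff s *: T (\val s) -
    (half_diff s *: T (\val s) - half_diff s *: (half_diff s)%:A) =
    (half_sum s ^+ 2)%:A.
  rewrite half_sum_sq mulr2n !scalerDl scale1r scalerA -expr2.
  set x := half_diff s *: T _; set y := _ *: 1.
  by rewrite [x + x + 1]addrAC addrK opprB addrA -[x + 1 + y]addrA addrC addKr.
by rewrite scalerA mulVf ?scale1r // expf_neq0 // half_sum_neq0.
Qed.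

Lemma T_gen_comm s t : scomm s t -> T (val s) * T (val t) = T (val t) * T (val s).
Proof.
case/andP=> nst /eqP cst; have nts : t != s by rewrite eq_sym.
by rewrite -!T_mul ?cst // !(len_gen hW hra) (len_gen2 hW hra) // -cst.
Qed.

Lemma gen_unit_comm s t : scomm s t ->
  gen_unit s * gen_unit t = gen_unit t * gen_unit s.
Proof.
move=> cst; rewrite /gen_unit -!scalerAl -!scalerAr !scalerA mulrC; congr (_ *: _).
rewrite !mulrBl !mulrBr T_gen_comm // -!scalerAl -!scalerAr !mul1r !mulr1.
rewrite !scalerA [half_diff t * _]mulrC !opprB -!addrA; congr (_ + _).
by rewrite !addrA addrAC [in RHS]addrC addrA.
Qed.

(** The image of w under the homomorphism from W to the units of H that extends
    gen_unit, computed on an arbitrary word for w; it does not depend on the word by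
    group_elt_eval. *)
Definition group_elt w : H :=
  \prod_(s <- xget [::] [set v : seq S | eval v = w]) gen_unit s.

Lemma prod_relator s t :
  \prod_(r <- flatten (nseq (ord (val s * val t)%g) [:: s; t])) gen_unit r = 1.
Proof.
have := hra s t; rewrite !inE => /or3P[] /eqP e; rewrite e /= ?big_nil //.
  by rewrite (ord1_eq hW e) !big_cons big_nil mulr1 gen_unit_sq.
have cst := ord2_scomm hW e.
rewrite !big_cons big_nil mulr1 !mulrA (gen_unit_comm cst) -[_ * _ * gen_unit s]mulrA.
by rewrite gen_unit_sq mulr1 gen_unit_sq.
Qed.

Lemma group_elt_eval v : group_elt (eval v) = \prod_(s <- v) gen_unit s.
Proof.
rewrite /group_elt.
have : eval (xget [::] [set x : seq S | eval x = eval v]) = eval v.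
  by have := @xgetI _ [::] [set x : seq S | eval x = eval v] v erefl.
move: (xget _ _) => x xv; case: hW => _ _ /(_ _ _ xv).
elim=> {x v xv} [||u v x _ -> _ ->|u v s t] //.
by rewrite !big_cat prod_relator /= mul1r.
Qed.

Lemma group_elt1 : group_elt 1%g = 1.
Proof. by rewrite -(eval_nil S) group_elt_eval big_nil. Qed.

Lemma group_eltM w g : group_elt (w * g)%g = group_elt w * group_elt g.
Proof.
have [u _ <-] := red_word hW w; have [v _ <-] := red_word hW g.
by rewrite -eval_cat !group_elt_eval big_cat.
Qed.

Lemma group_elt_gen s w : group_elt (val s * w)%g = gen_unit s * group_elt w.
Proof.
rewrite group_eltM; congr (_ * _).
rewrite -[val s]mulg1 -(eval_nil S) -eval_cons group_elt_eval.
by rewrite big_cons big_nil mulr1.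
Qed.

(** Induction on a reduced word: left multiplication by T_s, which is
    half_sum times a group element plus half_diff, raises lengths by at most 1. *)
Lemma T_triangular : triangular len group_elt T.
Proof.
move=> w; have [u ru <-] := red_word hW w.
elim: u ru => [|s u IH] ru.
  exists 1; rewrite ?oner_neq0 // eval_nil group_elt1 scale1r.
  by case: hT => _ -> _ _; rewrite subrr; apply: in_span0.
have /andP[_ ru'] := ru; have [a a0 sp] := IH ru'.
have lsu := len_red hW hra ru; have lu := len_red hW hra ru'.
exists (half_sum s * a); first by rewrite mulf_neq0 ?half_sum_neq0.
have -> : T (eval (s :: u)) = T (val s) * T (eval u).
  by rewrite eval_cons T_mul // -eval_cons lsu lu (len_gen hW hra) add1n.
rewrite lsu; set h := T (eval u) in sp *.
have TU w' : T (val s) * group_elt w' =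
    half_sum s *: group_elt (val s * w')%g + half_diff s *: group_elt w'.
  rewrite T_gen mulrDl group_elt_gen; congr (_ + _); first by rewrite scalerAl.
  by rewrite -scalerAl mul1r.
have -> : T (val s) * h - (half_sum s * a) *: group_elt (eval (s :: u)) =
    T (val s) * (h - a *: group_elt (eval u)) + (a * half_diff s) *: group_elt (eval u).
  rewrite mulrBr -scalerAr TU eval_cons scalerDr !scalerA [a * half_sum s]mulrC.
  by rewrite opprD addrA subrK.
apply: in_spanD; last by apply/in_spanZ/in_span_gen; rewrite lu.
apply: in_span_lin sp => [b x y|w' lw']; first by rewrite mulrDr -scalerAr.
rewrite TU; apply: in_spanD; apply/in_spanZ/in_span_gen; last first.
  by rewrite /= ltnS -lu ltnW.
rewrite /= ltnS -lu; apply: leq_trans (lenM hW hra _ _) _.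
by rewrite (len_gen hW hra) add1n.
Qed.

Lemma T_basis : basis T.
Proof.
case: hT => [[spT frT] _ _ _]; split=> // h.
by have [r [c ->]] := spT h; apply: in_span_sum.
Qed.

Lemma group_elt_basis : basis group_elt.
Proof. exact: triangular_basis (triangular_sym T_triangular) T_basis. Qed.

(** In the basis of group elements, tau (a b) = tau (b a) says that tau takes the
    same value at w g and at its conjugate g w. *)
Lemma trace_class_function (tau : H -> R[i]) : is_trace tau <->
  scalar tau /\ forall w g, tau (group_elt (w ^ g)%g) = tau (group_elt w).
Proof.
split=> [[lt tr]|[lt ct]]; split=> //.
  by move=> w g; rewrite conjgE group_eltM tr -group_eltM -mulgA mulgV mulg1.
have UU w g : tau (group_elt w * group_elt g) = tau (group_elt g * group_elt w).
  by rewrite -!group_eltM -(ct (w * g)%g w) conjgE !mulgA mulVg mul1g.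
have lin_l a : linear ((fun b => tau (a * b)) : H -> R[i]^o).
  by move=> k x y; rewrite mulrDr -scalerAr lt.
have lin_r a : linear ((fun b => tau (b * a)) : H -> R[i]^o).
  by move=> k x y; rewrite mulrDl -scalerAl lt.
case: group_elt_basis => sU _ a b.
apply: (linear_span_eq (lin_l a) (lin_r a)) (sU b) => g _.
by apply: (linear_span_eq (lin_r _) (lin_l _)) (sU a) => w _.
Qed.

(** * The cocenter *)

Definition conj_class w : set W := [set (w ^ g)%g | g in [set: W]].

Definition class_rep (O : set W) : W :=
  xget 1%g [set w | O w /\ min_len_in_class S w].

Lemma class_repP w : exists2 g, class_rep (conj_class w) = (w ^ g)%g &
  min_len_in_class S (class_rep (conj_class w)).
Proof.
suff exz : exists z, [set z | conj_class w z /\ min_len_in_class S z] z.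
  by have [[g _ e] mw] := xgetPex 1%g exz; exists g; rewrite -?e.
have ex : exists n, `[< exists g, len (w ^ g)%g = n >].
  by exists (len w); apply/asboolP; exists 1%g; rewrite conjg1.
case: (ex_minnP ex) => n /asboolP[g <-] h.
exists (w ^ g)%g; split; first by exists g.
by move=> k; apply: h; apply/asboolP; exists (g * k)%g; rewrite conjgM.
Qed.

Lemma conj_classJ w g : conj_class (w ^ g)%g = conj_class w.
Proof.
apply/seteqP; split=> _ [k _ <-]; first by exists (g * k)%g; rewrite ?conjgM.
by exists (g^-1 * k)%g; rewrite // -conjgM mulVKg.
Qed.

Local Notation rep w := (class_rep (conj_class w)).

Lemma repJ w g : rep (w ^ g)%g = rep w.
Proof. by rewrite conj_classJ. Qed.

Lemma conj_class_rep w : conj_class (rep w) = conj_class w.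
Proof. by have [g -> _] := class_repP w; rewrite conj_classJ. Qed.

Lemma len_rep w : (len (rep w) <= len w)%N.
Proof.
by have [g e m] := class_repP w; have := m (g^-1)%g; rewrite {2}e conjgK.
Qed.

(** A basis in which traces are visible: the vectors with w != rep w are killed by
    every trace, the others are the T_w at which a trace may be prescribed. *)
Definition adapted w : H :=
  if w == rep w then T w else group_elt w - group_elt (rep w).

(** Length alone does not order this family, since w and rep w may have the same
    length; the rank breaks the tie by placing rep w first. *)
Lemma adapted_basis : basis adapted.
Proof.
apply: (triangular_basis (rk := fun w => ((len w).*2 + (w != rep w))%N)) group_elt_basis.
move=> w; rewrite /adapted; case: (eqVneq w (rep w)) => [wr|nwr].
  have [a a0 sp] := T_triangular w; exists a => //.
  apply: in_span_mono sp => v vw; rewrite addn0.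
  by case: (v != _); rewrite ?addn0 ?addn1 ?ltn_double // ltn_Sdouble.
exists 1; first exact: oner_neq0.
rewrite scale1r addrAC subrr add0r; apply/in_spanN/in_span_gen.
by rewrite conj_class_rep eqxx addn0 addn1 ltnS leq_double len_rep.
Qed.

Lemma trace_adapted_nonrep (tau : H -> R[i]) w :
  is_trace tau -> w != rep w -> tau (adapted w) = 0.
Proof.
move=> tr nw; have [lt ct] := (trace_class_function tau).1 tr.
have [g e _] := class_repP w.
by rewrite /adapted (negPf nw) addrC -scaleN1r lt e ct mulN1r addNr.
Qed.

Lemma trace_rep_ext (tau tau' : H -> R[i]) : is_trace tau -> is_trace tau' ->
  (forall w, tau (T (rep w)) = tau' (T (rep w))) -> tau = tau'.
Proof.
move=> tr tr' e; apply/funext => h; case: adapted_basis => sV _.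
have [lt _] := tr; have [lt' _] := tr'.
apply: (linear_span_eq (V' := R[i]^o) lt lt') (sV h) => w _.
have [wr|nwr] := eqVneq w (rep w); last by rewrite !trace_adapted_nonrep.
by rewrite /adapted -wr eqxx wr e.
Qed.

Lemma trace_of_rep (f : W -> R[i]) : exists2 tau : H -> R[i], is_trace tau &
  forall w, tau (adapted w) = if w == rep w then f w else 0.
Proof.
have [tau [lt tV]] :=
  basis_functional (fun w => if w == rep w then f w else 0) adapted_basis.
exists tau => //; apply/trace_class_function; split; first exact: lt.
(* Vanishing on the differences makes tau a class function on group elements. *)
have Urep w : tau (group_elt w) = tau (group_elt (rep w)).
  have [<- //|nw] := eqVneq w (rep w).
  have := tV w; rewrite /adapted (negPf nw) addrC -scaleN1r lt scaleN1r addrC => /eqP.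
  by rewrite subr_eq0 => /eqP.
by move=> w g; rewrite Urep repJ -Urep.
Qed.

Lemma trace_min_len (tau : H -> R[i]) w : is_trace tau -> min_len_in_class S w ->
  tau (T w) = tau (T (rep w)).
Proof.
move=> tr mw; have [g e _] := class_repP w.
by rewrite e (trace_conj_min tr mw) // -e len_rep.
Qed.

(** The value at a single representative of each class suffices, because a trace
    does not distinguish elements of minimal length of the same class. *)
Lemma class_traceP w (phi : H -> R[i]) : class_trace S T (conj_class w) phi <->
  is_trace phi /\ forall z : W, phi (T (rep z)) = (rep z == rep w)%:R.
Proof.
have inE_ (v : W) : (v \in conj_class w) = (rep v == rep w).
  apply/idP/eqP => [|e].
    by rewrite inE => -[g _ <-]; rewrite repJ.
  have [g eg _] := class_repP v; have [k ek _] := class_repP w.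
  rewrite inE; exists (k * g^-1)%g => //.
  by rewrite conjgM -ek -e eg conjgK.
split=> -[tr h]; split=> //= v.
  by have [_ _ mr] := class_repP v; rewrite h // inE_ conj_class_rep.
by move=> mv; rewrite trace_min_len // h inE_.
Qed.

End Hecke.

(** * Sums over conjugacy classes *)

Section ClassSum.
Variables (R : realType) (W : groupType) (H : algType R[i]).
Variable phi : conj_classes W -> H -> R[i].
Hypothesis fin_phi : forall h, finite_set [set O | phi O h != 0].

Lemma class_sumE (c : conj_classes W -> R[i]) (r : seq (conj_classes W)) h :
  uniq r -> (forall O, phi O h != 0 -> O \in r) ->
  class_sum phi c h = \sum_(O <- r) c O * phi O h.
Proof.
move=> ur hr; rewrite /class_sum (fsbigE r) //=.
  by apply: eq_bigl => O; rewrite in_setT.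
move=> O _ /=; case: (eqVneq (phi O h) 0) => [->|/hr -> //].
by rewrite mulr0.
Qed.

(** Linearity and the trace property compare the sums at several vectors, and are
    checked over one finite set of classes that carries them all. *)
Lemma common_support (hs : seq H) : exists2 r : seq (conj_classes W), uniq r &
  forall h, h \in hs -> forall O, phi O h != 0 -> O \in r.
Proof.
pose A := \bigcup_(h in [set` hs]) [set O | phi O h != 0].
have finA : finite_set A by apply: bigcup_finite.
exists (fset_set A) => [|h hhs O p0]; first exact: fset_uniq.
by rewrite in_fset_set // inE; exists h.
Qed.

Lemma class_sum_linear : linear (class_sum phi).
Proof.
move=> k c d; apply/funext => h.
have [r ur /(_ h (mem_head _ _)) hr] := common_support [:: h].
rewrite -[RHS]/(k * class_sum phi c h + class_sum phi d h : R[i]).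
rewrite !(class_sumE _ ur hr) mulr_sumr -big_split; apply: eq_bigr => O _ /=.
by rewrite mulrA -mulrDl.
Qed.

Lemma class_sum_trace c : (forall O, is_trace (phi O)) -> is_trace (class_sum phi c).
Proof.
move=> tr; split=> [k a b|a b].
  have [r ur hr] := common_support [:: k *: a + b; a; b].
  rewrite !(class_sumE _ ur (hr _ _)) ?inE ?eqxx ?orbT //.
  rewrite mulr_sumr -big_split; apply: eq_bigr => O _ /=.
  by rewrite (tr O).1 mulrDr mulrCA.
have [r ur hr] := common_support [:: a * b; b * a].
rewrite !(class_sumE _ ur (hr _ _)) ?inE ?eqxx ?orbT //.
by apply: eq_bigr => O _; rewrite (tr O).2.
Qed.

End ClassSum.

(** * Traces and sequences indexed by conjugacy classes *)

Theorem theoremA (R : realType) (W : groupType) (S : {fset W}) (q : S -> R)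
    (H : algType R[i]) (T : W -> H)
    (hWS : coxeter_system S) (hra : right_angled S)
    (hq : forall s : S, 0 < q s) (hH : iwahori_hecke q T) :
  (forall O : conj_classes W,
     exists! phi : H -> R[i], class_trace S T (val O) phi) /\
  (forall phi : conj_classes W -> H -> R[i],
     (forall O : conj_classes W, class_trace S T (val O) (phi O)) ->
     [/\ forall h : H, finite_set [set O | phi O h != 0],
         linear (class_sum phi)
       & set_bij [set: conj_classes W -> R[i]^o]
                 [set tau : H -> R[i]^o | is_trace tau]
                 (class_sum phi)]).
Proof.
pose rep w := class_rep S (conj_class w).
have valO (O : conj_classes W) : exists w, val O = conj_class w.
  by case: O => O /= /set_mem.
have CP := class_traceP hWS hra hH.
have rep_inj w v : rep w = rep v -> conj_class w = conj_class v.
  by move=> e; rewrite -(conj_class_rep S w) -/(rep w) e (conj_class_rep S).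
split=> [O|phi phiP].
  have [w ->] := valO O.
  have [tau tr tV] := trace_of_rep hWS hra hH hq (fun v => (v == rep w)%:R).
  exists tau; split.
    apply/CP; split=> // v; have := tV (rep v).
    by rewrite /adapted (conj_class_rep S) eqxx.
  move=> tau' /CP[tr' e']; apply: (trace_rep_ext hWS hra hH hq tr tr') => v.
  by rewrite e'; have := tV (rep v); rewrite /adapted (conj_class_rep S) eqxx.
have trphi O : is_trace (phi O) by case: (phiP O).
have phi_rep O v : phi O (T (rep v)) = (val O == conj_class v)%:R.
  have [w ew] := valO O; have := phiP O; rewrite ew => /CP[_ ->].
  congr (_%:R); congr nat_of_bool; apply/eqP/eqP => [/rep_inj->//|e].
  by rewrite e.
have [sV _] := adapted_basis hWS hra hH hq.
have fin h : finite_set [set O | phi O h != 0].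
  have [r [c [_ _ ->]]] := in_span_uniq (sV h).
  (* The traces phi O that do not kill h are among the classes of the indices in
     an expansion of h in the adapted basis. *)
  apply: (@sub_finite_set _ _
    [set O | exists2 w, w \in r & val O = conj_class w]).
    move=> O /= p0; apply: contrapT => nex; move: p0; apply/negP; rewrite negbK.
    pose f : {linear H -> R[i]^o} :=
      HB.pack (phi O : H -> R[i]^o) (GRing.isLinear.Build _ _ _ _ _ (trphi O).1).
    rewrite -[phi O]/(f : H -> R[i]) linear_sum big_seq big1 // => w wr.
    rewrite linearZ /=; suff -> : phi O (adapted q T w) = 0 by rewrite scaler0.
    have [ew|nw] := eqVneq w (rep w); last exact: (trace_adapted_nonrep hWS hra hH hq).
    rewrite /adapted -/(rep w) -ew eqxx ew phi_rep; case: eqP => // e.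
    by case: nex; exists w.
  apply: (@sub_finite_set _ _ (val @^-1` [set conj_class w | w in [set` r]])).
    by move=> O [w wr e]; exists w.
  apply: finite_preimage; last exact/finite_image/finite_seq.
  by move=> x y _ _; apply: val_inj.
have sum_rep c O v : val O = conj_class v -> class_sum phi c (T (rep v)) = c O.
  move=> e; rewrite (@class_sumE _ _ _ _ _ [:: O]) //.
    by rewrite big_seq1 phi_rep e eqxx mulr1.
  move=> O'; apply: contraNT; rewrite inE phi_rep -e (inj_eq val_inj) => /negPf->.
  exact: eqxx.
split=> //; first exact: class_sum_linear.
split.
- by move=> c _; apply: class_sum_trace.
- move=> c d _ _ e; apply/funext => O; have [w ew] := valO O.
  by rewrite -(sum_rep c O w ew) e (sum_rep d O w ew).
- move=> tau /= tr.
  pose c (O : conj_classes W) : R[i] := tau (T (class_rep S (val O))).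
  (* A trace is the sum weighted by its own values at the representatives. *)
  exists c => //; apply: (trace_rep_ext hWS hra hH hq) => //.
    exact: class_sum_trace.
  move=> w.
  have cw : conj_class w \in conj_classes W by apply/mem_set; exists w.
  by rewrite -/(rep w) (sum_rep c (Sub (conj_class w) cw) w).
Qed.
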